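(* Let $K$ be a non-empty index set and let $X=(X(t))_{t\in K}$ be a real-valued stochastic process with $\mathbb{E}X(t)=0$ and $\mathbb{E}(X(t))^2<\infty$ for all $t\in K$. Suppose that $\rho(s,t):=\sqrt{\mathrm{Var}(X(s)-X(t))}$ defines a metric on $K$ which turns $K$ into a compact metric space, that $X$ has a.s. continuous sample paths on $(K,\rho)$, and that $\mathbb{E}[\sup_{t\in K}(X(t))^2]<\infty$. Let $(X_1(t))_{t\in K},(X_2(t))_{t\in K},\dots$ be independent copies of the process $X$ (each having a.s. continuous sample paths on $(K,\rho)$). For every $d\in\mathbb{N}$ put $$\mathbb{X}_d(t):=\frac{(X_1(t),\dots,X_d(t))}{\sqrt d}\in\mathbb{R}^d,\qquad t\in K,$$ and let $\mathbb{K}_d:=\{\mathbb{X}_d(t):t\in K\}\subset\mathbb{R}^d$ be endowed with the induced Euclidean metric. Then the random metric space $\mathbb{K}_d$ converges a.s., as $d\to\infty$, to the deterministic metric space $(K,\rho)$ in the Gromov-Hausdorff sense, that is, $$\mathbb{P}\left[\lim_{d\to\infty}d_{GH}(\mathbb{K}_d,K)=0\right]=1.$$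
   Context: The Gromov-Hausdorff distance $d_{GH}(E_1,E_2)$ between compact metric spaces $E_1,E_2$ is the infimum of $d_H(\varphi_1(E_1),\varphi_2(E_2))$ over all metric spaces $M$ and all isometric embeddings $\varphi_1:E_1\to M$, $\varphi_2:E_2\to M$, where $d_H$ denotes the Hausdorff distance between compact subsets of $M$. *)

(* Defs.v *)
From HB Require Import structures.
From mathcomp Require Import all_boot all_order all_algebra finmap.
From mathcomp Require Import ring lra.
From mathcomp Require Import all_classical all_reals all_analysis.

Set Implicit Arguments.
Unset Strict Implicit.
Unset Printing Implicit Defensive.

Import Order.TTheory GRing.Theory Num.Theory.
Import numFieldNormedType.Exports.

Local Open Scope classical_set_scope.
Local Open Scope ring_scope.

(* The library's metric on ['rV[R]_n] is the sup metric, whence this copy of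
   the type. *)
Definition euclidean (R : realType) (n : nat) : Type := 'rV[R]_n.

HB.instance Definition _ (R : realType) (n : nat) :=
  Choice.copy (euclidean R n) 'rV[R]_n.

Section euclidean_metric.
Variables (R : realType) (n : nat).
Implicit Types x y z : euclidean R n.

Definition euclidean_dist x y : R :=
  Num.sqrt (\sum_(i < n) ((x : 'rV[R]_n) 0 i - (y : 'rV[R]_n) 0 i) ^+ 2).

Lemma euclidean_distxx x : euclidean_dist x x = 0.
Proof.
by rewrite /euclidean_dist big1 ?sqrtr0// => i _; rewrite subrr expr0n.
Qed.

Lemma euclidean_dist_positivity x y : euclidean_dist x y = 0 -> x = y.
Proof.
move=> /eqP; rewrite sqrtr_eq0 => sum_le0; apply/rowP => i.
apply/eqP; rewrite -subr_eq0 -sqrf_eq0 eq_le sqr_ge0 andbT.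
apply: le_trans sum_le0; rewrite (bigD1 i)//= lerDl.
by apply: sumr_ge0 => j _; exact: sqr_ge0.
Qed.

Lemma euclidean_dist_sym x y : euclidean_dist x y = euclidean_dist y x.
Proof.
by congr Num.sqrt; apply: eq_bigr => i _; rewrite -sqrrN opprB.
Qed.

Lemma sum_cauchy_schwarz (a b : 'I_n -> R) :
  (\sum_i a i * b i) ^+ 2 <= (\sum_i a i ^+ 2) * (\sum_i b i ^+ 2).
Proof.
have : 0 <= \sum_i \sum_j (a i * b j - a j * b i) ^+ 2.
  by apply: sumr_ge0 => i _; apply: sumr_ge0 => j _; exact: sqr_ge0.
have -> : \sum_i \sum_j (a i * b j - a j * b i) ^+ 2 =
    \sum_i \sum_j (a i ^+ 2 * b j ^+ 2) + \sum_i \sum_j (b i ^+ 2 * a j ^+ 2)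
    - \sum_i \sum_j (2 * (a i * b i)) * (a j * b j).
  rewrite -big_split -sumrB; apply: eq_bigr => i _ /=.
  rewrite -big_split -sumrB; apply: eq_bigr => j _ /=; ring.
have double (f g : 'I_n -> R) :
    \sum_i \sum_j f i * g j = (\sum_i f i) * (\sum_j g j).
  by rewrite mulr_suml; apply: eq_bigr => i _; rewrite mulr_sumr.
rewrite !double -mulr_sumr; lra.
Qed.

Lemma euclidean_dist_triangle y x z :
  euclidean_dist x z <= euclidean_dist x y + euclidean_dist y z.
Proof.
pose a i := (x : 'rV[R]_n) 0 i - (y : 'rV[R]_n) 0 i.
pose b i := (y : 'rV[R]_n) 0 i - (z : 'rV[R]_n) 0 i.
have -> : euclidean_dist x z = Num.sqrt (\sum_(i < n) (a i + b i) ^+ 2).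
  by congr Num.sqrt; apply: eq_bigr => i _; rewrite /a /b addrA subrK.
rewrite -[euclidean_dist x y]/(Num.sqrt (\sum_(i < n) a i ^+ 2)).
rewrite -[euclidean_dist y z]/(Num.sqrt (\sum_(i < n) b i ^+ 2)).
have A0 : 0 <= \sum_(i < n) a i ^+ 2 by apply: sumr_ge0 => i _; exact: sqr_ge0.
have B0 : 0 <= \sum_(i < n) b i ^+ 2 by apply: sumr_ge0 => i _; exact: sqr_ge0.
rewrite -[leLHS]ger0_norm ?sqrtr_ge0// -ler_sqr ?nnegrE ?addr_ge0 ?sqrtr_ge0//.
rewrite ger0_norm ?sqrtr_ge0// sqr_sqrtr; last first.
  by apply: sumr_ge0 => i _; exact: sqr_ge0.
rewrite sqrrD !sqr_sqrtr// -sqrtrM//.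
under eq_bigr do rewrite sqrrD.
rewrite !big_split/= -mulr2n lerD2r lerD2l lerMn2r/=.
apply: le_trans (ler_norm _) _; rewrite -sqrtr_sqr; apply: ler_wsqrtr.
exact: sum_cauchy_schwarz.
Qed.

HB.instance Definition _ := @isMetric.Build R (euclidean R n) euclidean_dist
  euclidean_distxx euclidean_dist_positivity euclidean_dist_sym
  euclidean_dist_triangle.

End euclidean_metric.

Section induced_metric.
Variables (R : realType) (T : metricType R) (A : set T).

Definition induced_dist (x y : A) : R := mdist (set_val x) (set_val y).

Lemma induced_dist_ge0 x y : 0 <= induced_dist x y.
Proof. exact: mdist_ge0. Qed.

Lemma induced_dist_positivity x y : induced_dist x y = 0 -> x = y.
Proof. by move=> /mdist_positivity /val_inj. Qed.

Lemma ballE_induced_dist (x : A) (e : R) :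
  ball x e = [set y | induced_dist x y < e].
Proof.
have -> : ball x e = set_val @^-1` (ball (set_val x) e) by [].
by rewrite ballEmdist.
Qed.

HB.instance Definition _ := @PseudoMetric_isMetric.Build R (A : Type)
  induced_dist induced_dist_ge0 induced_dist_positivity ballE_induced_dist.

End induced_metric.

Section gromov_hausdorff.
Variable R : realType.
Local Open Scope ereal_scope.

Definition dist_to_set (M : metricType R) (x : M) (A : set M) : \bar R :=
  ereal_inf [set (mdist x y)%:E | y in A].

Definition hausdorff_dist (M : metricType R) (A B : set M) : \bar R :=
  maxe (ereal_sup [set dist_to_set a B | a in A])
       (ereal_sup [set dist_to_set b A | b in B]).

Definition isometric_embedding (E M : metricType R) (phi : E -> M) : Prop :=
  forall x y, mdist (phi x) (phi y) = mdist x y.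

Definition gromov_hausdorff_dist (E1 E2 : metricType R) : \bar R :=
  ereal_inf [set r | exists (M : metricType R) (phi1 : E1 -> M) (phi2 : E2 -> M),
    [/\ isometric_embedding phi1, isometric_embedding phi2 &
        r = hausdorff_dist (range phi1) (range phi2)]].

End gromov_hausdorff.

Section processes.
Variables (R : realType) (K : Type).
Local Open Scope ereal_scope.

(* The product sigma-algebra on [K -> R], [R] carrying its Borel sets. *)
Definition path_measurable : set (set (K -> R)) :=
  <<s [set A | exists (t : K) (B : set R),
         measurable B /\ A = (fun f : K -> R => f t) @^-1` B] >>.

Definition sample_path d (T : measurableType d) (P : probability T R)
  (X : K -> {RV P >-> R}) (w : T) : K -> R := fun t => X t w.

(* The processes may live on different probability spaces. *)
Definition same_law d (T : measurableType d) (P : probability T R)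
    d' (T' : measurableType d') (P' : probability T' R)
    (X : K -> {RV P >-> R}) (Y : K -> {RV P' >-> R}) : Prop :=
  forall A, path_measurable A ->
    P (sample_path X @^-1` A) = P' (sample_path Y @^-1` A).

Definition independent_processes d (T : measurableType d) (P : probability T R)
    (Y : nat -> K -> {RV P >-> R}) : Prop :=
  forall (J : {fset nat}) (A : nat -> set (K -> R)),
    (forall i, i \in J -> path_measurable (A i)) ->
    P (\bigcap_(i in [set` J]) (sample_path (Y i) @^-1` A i)) =
    \prod_(i <- J) P (sample_path (Y i) @^-1` A i).

End processes.

(* [Y i] stands for the (i+1)-st copy, so that [Y 0], ..., [Y d.-1] are the
   first [d] ones. *)
Definition random_embedding (R : realType) (K : Type) d0 (T : measurableType d0)
    (P : probability T R) (Y : nat -> K -> {RV P >-> R}) (w : T) (d : nat)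
    (t : K) : euclidean R d :=
  \row_(i < d) (Y i t w / Num.sqrt d%:R).

Definition random_space (R : realType) (K : Type) d0 (T : measurableType d0)
    (P : probability T R) (Y : nat -> K -> {RV P >-> R}) (w : T) (d : nat) :
    set (euclidean R d) :=
  range (random_embedding Y w d).
Arguments random_space {R K d0 T P} Y w d _.

(* Main.v *)
Require Import Defs.
From HB Require Import structures.
From mathcomp Require Import all_boot all_order all_algebra finmap.
From mathcomp Require Import zify ring lra.
From mathcomp Require Import all_classical all_reals all_analysis.
From mathcomp Require Import measurable_realfun.

Set Implicit Arguments.
Unset Strict Implicit.
Unset Printing Implicit Defensive.

Import Order.TTheory GRing.Theory Num.Theory.
Import numFieldNormedType.Exports.

Local Open Scope classical_set_scope.
Local Open Scope ring_scope.

(* The core is a uniform law of large numbers: almost surely,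
   |X_d(s) - X_d(t)| -> rho(s, t) uniformly in s and t. For fixed s and t, the
   square of the left-hand side is the empirical mean of the i.i.d. variables
   (X_i(s) - X_i(t))^2, and the strong law applies. For uniformity, let W_{p,r}
   be the supremum of (X(s) - X(p))^2 over the s in a countable dense subset of
   the ball B(p, r). By sample continuity W_{p,r} -> 0 as r -> 0, and dominated
   convergence with dominating function 2 sup X^2 + 2 X(p)^2 gives
   E W_{p,r} -> 0. Finitely many balls on which this expectation is at most
   e^2 cover K; the strong law for W_{p,r} bounds |X_d(s) - X_d(p)| by e on each
   of them, which reduces the uniform statement to the finitely many centers.
   Finally a surjection of distortion at most e yields d_GH <= e, by gluing the
   two spaces along it.

   The strong law is proved by Etemadi's method: truncation at level k_j along a
   sequence k_j of ratio close to 1, and monotone interpolation. *)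

(** * The strong law of large numbers *)

Section independence.
Context d (T : measurableType d) (R : realType) (P : probability T R).
Local Open Scope ereal_scope.

(** The joint law of [U] and [V] agrees with the product of their laws on rectangles, hence
    everywhere, and Tonelli's theorem splits the integral. *)
Lemma expectation_mul_indep (U V : {RV P >-> R}) :
  (forall x, 0 <= U x)%R -> (forall x, 0 <= V x)%R ->
  (forall A B, measurable A -> measurable B ->
    P (U @^-1` A `&` V @^-1` B) = P (U @^-1` A) * P (V @^-1` B)) ->
  'E_P[U \* V] = 'E_P[U] * 'E_P[V].
Proof.
move=> U0 V0 UV.
pose W x : R * R := (U x, V x).
have mW : measurable_fun setT W by exact/measurable_fun_pair.
pose W' : {mfun T >-> (R * R)%type} :=
  HB.pack W (isMeasurableFun.Build _ _ _ _ W mW).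
have prodE A : measurable A ->
    (distribution P U \x distribution P V) A = distribution P W' A.
  apply: product_measure_unique => B C mB mC.
  rewrite /distribution/= /pushforward/= -UV//; congr (P _).
(* Positive parts make the integrand non-negative on the whole plane, as Tonelli requires; they fix
   the values of [U] and [V]. *)
pose f (z : R * R) := (Num.max 0 z.1 * Num.max 0 z.2)%:E.
have mmax : measurable_fun [set: R] (Num.max 0 : R -> R)%R.
  exact: measurable_maxr.
have mf : measurable_fun [set: R * R] f.
  apply/measurable_EFinP/measurable_funM => /=.
    exact: (measurableT_comp mmax).
  exact: (measurableT_comp mmax).
have f0 z : 0 <= f z by rewrite lee_fin mulr_ge0// le_max lexx.
have := @ge0_integral_distribution _ _ _ _ _ P W' f mf f0.
rewrite (eq_measure_integral (distribution P U \x distribution P V));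
  last first.
    by move=> A mA _; exact/esym/prodE.
rewrite fubini_tonelli1//.
rewrite /fubini_F/= /f/=.
have mE : measurable_fun [set: R] (fun x : R => (Num.max 0 x)%:E).
  exact/measurable_EFinP.
under eq_integral => x _.
  under eq_integral => y _ do rewrite EFinM.
  rewrite ge0_integralZl//; last 2 first.
    by move=> y _; rewrite lee_fin le_max lexx.
    by rewrite lee_fin le_max lexx.
  over.
rewrite ge0_integralZr//; last 2 first.
  by move=> y _; rewrite lee_fin le_max lexx.
  by apply: integral_ge0 => y _; rewrite lee_fin le_max lexx.
rewrite !ge0_integral_distribution//; last 2 first.
  by move=> y; rewrite lee_fin le_max lexx.
  by move=> y; rewrite lee_fin le_max lexx.
have maxE (W0 : T -> R) : (forall x, 0 <= W0 x)%R ->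
    (fun y => (Num.max 0 y)%:E) \o W0 = EFin \o W0.
  by move=> W00; apply/funext => x /=; rewrite max_r.
rewrite !maxE// unlock => ->; apply: eq_integral => x _ /=.
by rewrite !max_r.
Qed.

Lemma sqr_integrable_Lfun2 (U : {RV P >-> R}) :
  'E_P[fun w => (U w ^+ 2)%R] < +oo -> (U : T -> R) \in Lfun P 2%:E.
Proof.
move=> U2; rewrite inE; apply/andP; split; rewrite inE/=.
  exact: measurable_funPT.
rewrite /finite_norm unlock /Lnorm poweR_lty//.
apply: le_lt_trans U2; rewrite unlock le_eqVlt; apply/orP; left; apply/eqP.
apply: eq_integral => w _ /=.
by rewrite powR_mulrn// real_normK// num_real.
Qed.

Lemma bounded_Lfun2 (U : {RV P >-> R}) (c : R) :
  (forall x, `|U x| <= c)%R -> (U : T -> R) \in Lfun P 2%:E.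
Proof.
move=> Uc; apply: sqr_integrable_Lfun2.
apply: (@le_lt_trans _ _ 'E_P[cst (c ^+ 2)%R]).
  apply: expectation_le => //; first exact: measurable_funX.
  - by move=> x; exact: sqr_ge0.
  - by move=> x; exact: sqr_ge0.
  - apply: aeW => x; rewrite -(real_normK (num_real (U x))).
    by rewrite lerXn2r ?nnegrE// (le_trans _ (Uc x)).
by rewrite expectation_cst ltry.
Qed.

(** By bilinearity a partial sum is uncorrelated with the next variable, so the variances add up by
    induction; the bound [c] puts everything in L^2. *)
Lemma variance_sum_indep (U : nat -> {RV P >-> R}) (c : R) n :
  (forall i x, 0 <= U i x <= c)%R ->
  (forall i j, i != j -> 'E_P[U i \* U j] = 'E_P[U i] * 'E_P[U j]) ->
  'V_P[(fun w => \sum_(i < n) U i w)%R] = (\sum_(i < n) 'V_P[U i])%E.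
Proof.
move=> U0c UU.
have U2 i : (U i : T -> R) \in Lfun P 2%:E.
  apply: (@bounded_Lfun2 _ c) => x; have /andP[U0 Uc] := U0c i x.
  by rewrite ger0_norm.
have Pfin : P setT \is a fin_num := fin_num_measure P _ measurableT.
have SE m : (fun w => \sum_(i < m) U i w)%R = (\sum_(i < m) (U i : T -> R))%R.
  by apply/funext => w; rewrite fct_sumE.
have S2 m : (fun w => \sum_(i < m) U i w)%R \in Lfun P 2%:E.
  by rewrite SE; apply: rpred_sum => /= *; rewrite ?lee1n.
have covS m k : (m <= k)%N ->
    covariance P (fun w => \sum_(i < m) U i w)%R (U k) = 0.
  elim: m => [|m IHm] mk.
    rewrite (_ : (fun _ => _) = cst 0%R) ?covariance_cst_l//.
    by apply/funext => w; rewrite big_ord0.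
  rewrite (_ : (fun _ => _) =
      (fun w => \sum_(i < m) U i w)%R \+ (U m : T -> R))%R; last first.
    by apply/funext => w /=; rewrite big_ord_recr.
  rewrite covarianceDl// IHm ?(ltnW mk)// add0e.
  have U1 i := Lfun_subset12 Pfin (U2 i).
  rewrite (covarianceE (U1 m) (U1 k) (Lfun2_mul_Lfun1 (U2 m) (U2 k))).
  rewrite [X in 'E_P[X] - _](_ : _ = U m \* U k)%R// UU ?subee ?neq_ltn ?mk//.
  by rewrite fin_numM// expectation_fin_num// Lfun_subset12.
elim: n => [|n IHn].
  rewrite big_ord0 (_ : (fun _ => _) = cst 0%R) ?variance_cst//.
  by apply/funext => w; rewrite big_ord0.
rewrite big_ord_recr/= -IHn (_ : (fun _ => _) =
      (fun w => \sum_(i < n) U i w)%R \+ (U n : T -> R))%R; last first.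
  by apply/funext => w /=; rewrite big_ord_recr.
by rewrite varianceD// covS// mule0 adde0.
Qed.

End independence.

Section ae_series.
Context d (T : measurableType d) (R : realType) (P : probability T R).
Local Open Scope ereal_scope.

(** The series has finite expectation, so almost surely it converges and its terms tend to 0. This
    takes the place of Chebyshev and Borel-Cantelli. *)
Lemma ae_cvg0_summable (f : nat -> T -> R) :
  (forall j, measurable_fun setT (f j)) -> (forall j w, 0 <= f j w)%R ->
  \sum_(j <oo) 'E_P[f j] < +oo ->
  {ae P, forall w, f ^~ w @ \oo --> 0%R}.
Proof.
move=> mf_ f0 sumf.
have mf j : measurable_fun setT (fun w => (f j w)%:E) by exact/measurable_EFinP.
have intf : P.-integrable setT (fun w => \sum_(j <oo) (f j w)%:E).
  apply/integrableP; split.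
    by apply: ge0_emeasurable_sum => // j x _; rewrite lee_fin.
  under eq_integral => w _.
    rewrite gee0_abs; last by apply: nneseries_ge0 => j _ _; rewrite lee_fin.
    over.
  rewrite /=.
  rewrite integral_nneseries//; last by move=> j w _; rewrite lee_fin.
  by move: sumf; under eq_eseriesr do rewrite unlock.
have := integrable_ae measurableT intf; apply: filterS => w /(_ I) fw.
have cf : EFin \o series (f ^~ w) @ \oo --> (fine (\sum_(j <oo) (f j w)%:E))%:E.
  rewrite fineK//.
  have := @is_cvg_nneseries R (fun j => (f j w)%:E) xpredT 0%N.
  have -> : (fun n => \sum_(0 <= i < n | xpredT i) (f i w)%:E) =
      EFin \o series (f ^~ w).
    by apply/funext => n /=; rewrite /series/= sumEFin.
  by apply=> j _ _; rewrite lee_fin.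
apply: cvg_series_cvg_0; apply/cvg_ex; eexists; exact: fine_cvg cf.
Qed.

End ae_series.

Section identically_distributed.
Context d (T : measurableType d) (R : realType) (P : probability T R).
Context d' (T' : measurableType d') (P' : probability T' R).
Local Open Scope ereal_scope.

Lemma eq_distribution_integral (U : {RV P >-> R}) (U' : {RV P' >-> R})
    (g : R -> R) :
  (forall A, measurable A -> P (U @^-1` A) = P' (U' @^-1` A)) ->
  measurable_fun setT g -> (forall x, 0 <= g x)%R ->
  \int[P]_w (g (U w))%:E = \int[P']_w (g (U' w))%:E.
Proof.
move=> UU' mg g0.
have mE : measurable_fun [set: R] (EFin \o g) by exact/measurable_EFinP.
have E0 y : 0 <= (EFin \o g) y by rewrite lee_fin.
rewrite -[LHS](ge0_integral_distribution U mE E0).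
rewrite -[RHS](ge0_integral_distribution U' mE E0).
by apply: eq_measure_integral => A mA _; exact: UU'.
Qed.

End identically_distributed.

(** * Convergence along a subsequence, by truncation *)

Section strong_law.
Context d (T : measurableType d) (R : realType) (P : probability T R).
Variable Z : nat -> {RV P >-> R}.
Hypothesis Z_ge0 : forall i w, 0 <= Z i w.
Hypothesis Z_law : forall i A, measurable A ->
  P (Z i @^-1` A) = P (Z 0 @^-1` A).
Hypothesis Z_indep : forall i j, i != j -> forall A B, measurable A ->
  measurable B ->
  P (Z i @^-1` A `&` Z j @^-1` B) = (P (Z i @^-1` A) * P (Z j @^-1` B))%E.
Hypothesis Z_integrable : ('E_P[Z 0] < +oo)%E.

(** A minimum instead of an indicator: where truncation acts, the value is [c] itself, so a small
    sum of squares rules truncation out. *)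
Let trunc (c : R) i w := Num.min (Z i w) c.

Let measurable_trunc c i : measurable_fun setT (trunc c i).
Proof. exact: measurable_minr. Qed.

HB.instance Definition _ c i :=
  isMeasurableFun.Build _ _ _ _ (trunc c i) (measurable_trunc c i).

Let trunc_ge0 c i w : 0 <= c -> 0 <= trunc c i w.
Proof. by move=> c0; rewrite le_min Z_ge0. Qed.

Let trunc_law (g : R -> R) c i :
  measurable_fun setT g -> (forall x, 0 <= g x) ->
  (\int[P]_w (g (trunc c i w))%:E = \int[P]_w (g (trunc c 0 w))%:E)%E.
Proof.
move=> mg g0.
apply: (@eq_distribution_integral _ _ _ _ _ _ _ _ _ (g \o Num.min^~ c)) => //.
- exact: Z_law.
- by apply: measurableT_comp => //; exact: measurable_minr.
- by move=> x /=.
Qed.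

Let trunc_indep c i j : 0 <= c -> i != j ->
  ('E_P[trunc c i \* trunc c j] = 'E_P[trunc c i] * 'E_P[trunc c j])%E.
Proof.
move=> c0 ij; apply: (@expectation_mul_indep _ _ _ P (trunc c i) (trunc c j)).
- by move=> x; exact: trunc_ge0.
- by move=> x; exact: trunc_ge0.
- move=> A B mA mB.
  have mc : measurable_fun [set: R] (Num.min^~ c) by exact: measurable_minr.
  have := Z_indep ij (mc measurableT A mA) (mc measurableT B mB).
  by rewrite !setTI.
Qed.

Let mean c : R := fine 'E_P[trunc c 0].
Let energy c : \bar R := 'E_P[fun w => trunc c 0 w ^+ 2].

Let trunc_mean c i : 0 <= c -> ('E_P[trunc c i] = (mean c)%:E)%E.
Proof.
move=> c0; rewrite fineK.
  rewrite unlock.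
  (* [trunc_law] asks for a function that is non-negative on the whole line; the positive part is
     one, and it fixes the truncated values. *)
  have := @trunc_law (Num.max 0) c i.
  under eq_integral => w _ do rewrite max_r ?trunc_ge0//.
  under [in RHS]eq_integral => w _ do rewrite max_r ?trunc_ge0//.
  apply; first exact: measurable_maxr.
  by move=> x; rewrite le_max lexx.
rewrite ge0_fin_numE; last by apply: expectation_ge0 => w; exact: trunc_ge0.
apply: le_lt_trans Z_integrable; apply: expectation_le => //.
- by move=> w; exact: trunc_ge0.
- by apply: aeW => w; rewrite /trunc ge_min lexx.
Qed.

Let trunc_energy c i : ('E_P[fun w => (trunc c i w ^+ 2)%R] = energy c)%E.
Proof.
rewrite /energy unlock; apply: (@trunc_law (fun x => x ^+ 2)).
  exact: measurable_funX.
by move=> x; exact: sqr_ge0.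
Qed.

(** The left-hand side is the variance of an average of [k] uncorrelated variables, each of variance
    at most [energy c]. *)
Let square_mean_error c k : 0 <= c -> (0 < k)%N ->
  ('E_P[fun w => (((\sum_(i < k) trunc c i w) / k%:R - mean c) ^+ 2)%R]
     <= energy c * (k%:R^-1)%:E)%E.
Proof.
move=> c0 k0.
have tb i w : 0 <= trunc c i w <= c.
  by rewrite trunc_ge0//= /trunc ge_min lexx orbT.
have T2 i : trunc c i \in Lfun P 2%:E.
  apply: (@bounded_Lfun2 _ _ _ P (trunc c i) c) => x.
  by have /andP[t0 tc] := tb i x; rewrite ger0_norm.
have Pfin : P setT \is a fin_num := fin_num_measure P _ measurableT.
have ES : ('E_P[fun w => (\sum_(i < k) trunc c i w)%R] = (k%:R * mean c)%:E)%E.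
  rewrite unlock.
  under eq_integral => w _ do rewrite -sumEFin.
  rewrite ge0_integral_sum//; last 2 first.
    by move=> i; apply/measurable_EFinP.
    by move=> i w _; rewrite lee_fin trunc_ge0.
  under eq_bigr => i _.
    have := trunc_mean i c0; rewrite unlock => ->; over.
  by rewrite sumEFin big_const_ord iter_addr_0 mulr_natl.
have Vle i : ('V_P[trunc c i] <= energy c)%E.
  rewrite varianceE// -(trunc_energy c i).
  rewrite leeBlDr ?leeDl// ?sqre_ge0// fin_numX// expectation_fin_num//.
  exact: Lfun_subset12.
have VS : ('V_P[fun w => (\sum_(i < k) trunc c i w)%R] <= k%:R%:E * energy c)%E.
  rewrite (@variance_sum_indep _ _ _ P (fun i => trunc c i) c k tb
    (fun i j ij => trunc_indep c0 ij)).
  apply: (@le_trans _ _ (\sum_(i < k) energy c)%E).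
    by apply: lee_sum => i _; exact: Vle.
  by rewrite sumr_const card_ord mule_natl.
move: VS; rewrite /variance unlock ES/= => VS.
have -> : (fun w => ((\sum_(i < k) trunc c i w) / k%:R - mean c) ^+ 2) =
   (fun w => (k%:R ^- 2) * ((\sum_(i < k) trunc c i w - k%:R * mean c) *
     (\sum_(i < k) trunc c i w - k%:R * mean c))).
  by apply/funext => w; field; rewrite pnatr_eq0 -lt0n.
move: VS; rewrite {1}unlock => VS; rewrite {1}unlock.
under eq_integral => w _ do rewrite EFinM.
rewrite ge0_integralZl//; last 2 first.
- apply/measurable_EFinP/measurable_funM; apply: measurable_funB => //;
    by apply: measurable_sum.
- by move=> w _; rewrite lee_fin -expr2 sqr_ge0.
rewrite (le_trans (lee_wpmul2l _ VS))// ?lee_fin ?invr_ge0 ?exprn_ge0//.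
rewrite muleA -EFinM muleC (_ : k%:R ^- 2 * k%:R = k%:R^-1)//.
by field; rewrite pnatr_eq0 -lt0n.
Qed.

Let square_count c k : 0 <= c -> (0 < k)%N ->
  ('E_P[fun w => (\sum_(i < k) (trunc c i w / k%:R) ^+ 2)%R]
     <= energy c * (k%:R^-1)%:E)%E.
Proof.
move=> c0 k0; rewrite {1}unlock.
under eq_integral => w _ do rewrite -sumEFin.
have mt i : measurable_fun [set: T] (fun w => trunc c i w / k%:R).
  by apply: measurable_funM.
rewrite ge0_integral_sum//; last 2 first.
  by move=> i; apply/measurable_EFinP; exact: measurable_funX.
  by move=> i w _; rewrite lee_fin sqr_ge0.
have Ei i : (\int[P]_w ((trunc c i w / k%:R) ^+ 2)%:E =
    (k%:R^-1 ^+ 2)%:E * energy c)%E.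
  rewrite -(trunc_energy c i) unlock -ge0_integralZl//; last 2 first.
  - by apply/measurable_EFinP; exact: measurable_funX.
  - by move=> w _; rewrite lee_fin sqr_ge0.
  by apply: eq_integral => w _; rewrite exprMn mulrC EFinM.
under eq_bigr do rewrite Ei.
apply: (@le_trans _ _ (k%:R%:E * ((k%:R^-1 ^+ 2)%:E * energy c))%E).
  by rewrite sumr_const card_ord mule_natl.
rewrite muleA -EFinM muleC.
rewrite (_ : k%:R * k%:R^-1 ^+ 2 = k%:R^-1)//.
by field; rewrite pnatr_eq0 -lt0n.
Qed.

(* Along [k], the squared errors of the truncated averages and the counts
   [sum_(i < k j) (min(Z_i, k_j) / k_j) ^ 2], which are at least 1 as soon as
   one summand is truncated, have summable expectations. *)
Variables (k : nat -> nat) (C : R).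
Hypothesis k_gt0 : forall j, (0 < k j)%N.
Hypothesis k_cvgy : (k j)%:R @[j --> \oo] --> (+oo : set_system R).
Hypothesis k_sum : forall z n, 0 <= z ->
  \sum_(j < n) Num.min z (k j)%:R ^+ 2 / (k j)%:R <= C * z.

(** Summing under the expectation turns each partial sum into the expectation of the left-hand side
    of [k_sum] at [z = Z 0], which is at most [C] times that of [Z 0]. *)
Let energy_sum :
  (\sum_(j <oo) energy (k j)%:R * ((k j)%:R^-1)%:E < +oo)%E.
Proof.
(* For [z = 1] and the empty sum, [k_sum] reads [0 <= C]. *)
have C0 : 0 <= C by have := @k_sum 1 0%N ler01; rewrite big_ord0 mulr1.
have energy_ge0 c : (0 <= energy c)%E.
  by apply: expectation_ge0 => w; exact: sqr_ge0.
apply: (@le_lt_trans _ _ (C%:E * 'E_P[Z 0])%E); last first.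
  by rewrite lte_mul_pinfty// ?lee_fin// ge0_fin_numE// expectation_ge0.
apply: lime_le.
  by apply: is_cvg_nneseries => j _ _; rewrite mule_ge0// lee_fin invr_ge0.
apply: nearW => n.
have mt j : measurable_fun setT (fun w => trunc (k j)%:R 0 w ^+ 2).
  by apply: measurable_funX.
have -> : (\sum_(0 <= j < n) energy (k j)%:R * ((k j)%:R^-1)%:E =
  \int[P]_w (\sum_(j < n) trunc (k j)%:R 0 w ^+ 2 / (k j)%:R)%:E)%E.
  under [RHS]eq_integral => w _ do rewrite -sumEFin.
  rewrite ge0_integral_sum//; last 2 first.
    by move=> j; apply/measurable_EFinP/measurable_funM.
    by move=> j w _; rewrite lee_fin divr_ge0// sqr_ge0.
  rewrite big_mkord; apply: eq_bigr => j _.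
  rewrite /energy unlock -ge0_integralZr//; last 2 first.
  - exact/measurable_EFinP.
  - by move=> w _; rewrite lee_fin sqr_ge0.
rewrite expectation_def -ge0_integralZl//; last 2 first.
- exact/measurable_EFinP.
- by move=> w _; rewrite lee_fin.
apply: ge0_le_integral => //.
- by move=> w _; rewrite lee_fin sumr_ge0// => j _; rewrite divr_ge0// sqr_ge0.
- by apply/measurable_EFinP/measurable_sum => j; exact: measurable_funM.
- by apply/measurable_EFinP/measurable_funM.
- by move=> w _; rewrite -EFinM lee_fin; exact: k_sum.
Qed.

(** Dominated convergence with bound [Z 0]: at each point the truncation eventually stops acting. *)
Let mean_cvg : mean (k j)%:R @[j --> \oo] --> fine 'E_P[Z 0].
Proof.
have Zfin w : trunc (k j)%:R 0 w @[j --> \oo] --> Z 0 w.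
  apply: cvg_near_cst; near=> j; rewrite /trunc min_l//; near: j.
  by move/cvgryPge : k_cvgy; apply.
have intZ : P.-integrable setT (EFin \o Z 0).
  apply/integrableP; split; first exact/measurable_EFinP.
  under eq_integral do rewrite gee0_abs ?lee_fin//.
  by move: Z_integrable; rewrite unlock.
have [] := @dominated_convergence _ _ _ P setT measurableT
  (fun j w => (trunc (k j)%:R 0 w)%:E) (EFin \o Z 0) (EFin \o Z 0) _ _ _ intZ.
- by move=> j; exact/measurable_EFinP.
- exact/measurable_EFinP.
- by apply: aeW => w _; apply: cvg_EFin; [exact: nearW|exact: Zfin].
- apply: aeW => w j _; rewrite gee0_abs ?lee_fin ?trunc_ge0//.
  by rewrite /trunc ge_min lexx.
move=> _ _ lim; rewrite /mean unlock; apply: fine_cvg.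
rewrite fineK; last exact: integrable_fin_num.
exact: lim.
Unshelve. all: by end_near. Qed.

(** Almost surely [f] and [g] tend to 0: the truncated averages approach their means, which tend to
    the expectation of [Z 0], and eventually none of the first [k j] variables is truncated. *)
Lemma subsequence_strong_law :
  {ae P, forall w,
    (\sum_(i < k j) Z i w) / (k j)%:R @[j --> \oo] --> fine 'E_P[Z 0]}.
Proof.
have kR j : 0 < (k j)%:R :> R by rewrite ltr0n.
have k0 j : 0 <= (k j)%:R :> R by [].
have mt j i : measurable_fun setT (trunc (k j)%:R i) by [].
have fin_sum (f : nat -> T -> R) : (forall j w, 0 <= f j w) -> 
    (forall j, 'E_P[f j] <= energy (k j)%:R * ((k j)%:R^-1)%:E)%E ->
    (\sum_(j <oo) 'E_P[f j] < +oo)%E.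
  move=> f0 fle; apply: le_lt_trans energy_sum.
  apply: lee_nneseries => // j _ _.
  exact: expectation_ge0.
pose f j w :=
  ((\sum_(i < k j) trunc (k j)%:R i w) / (k j)%:R - mean (k j)%:R) ^+ 2.
pose g j w := \sum_(i < k j) (trunc (k j)%:R i w / (k j)%:R) ^+ 2.
have f0 j w : 0 <= f j w by exact: sqr_ge0.
have g0 j w : 0 <= g j w by apply: sumr_ge0 => i _; exact: sqr_ge0.
have mf j : measurable_fun setT (f j).
  apply/measurable_funX/measurable_funB => //.
  by apply: measurable_funM => //; exact: measurable_sum.
have mg j : measurable_fun setT (g j).
  by apply: measurable_sum => i; apply/measurable_funX/measurable_funM.
have := ae_cvg0_summable mf f0
  (fin_sum _ f0 (fun j => square_mean_error (k0 j) (k_gt0 j))).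
have := ae_cvg0_summable mg g0
  (fin_sum _ g0 (fun j => square_count (k0 j) (k_gt0 j))).
apply: filterS2 => w gw fw.
have truncE : \forall j \near \oo,
    forall i : 'I_(k j), trunc (k j)%:R i w = Z i w.
  have : \forall j \near \oo, g j w < 1.
    exact: (cvgr_lt _ gw).
  apply: filterS => j gj i; rewrite /trunc min_l//.
  rewrite leNgt; apply/negP => kZ.
  move: gj; rewrite ltNge => /negP; apply.
  rewrite /g (bigD1 i)//= {1}/trunc min_r ?(ltW kZ)// divff ?gt_eqF//.
  rewrite expr1n lerDl.
  by apply: sumr_ge0 => l _; exact: sqr_ge0.
have err : (\sum_(i < k j) trunc (k j)%:R i w) / (k j)%:R - mean (k j)%:R
    @[j --> \oo] --> (0 : R).
  have := cvg_comp _ _ fw (@sqrt_continuous R 0).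
  rewrite sqrtr0 => sw; apply/norm_cvg0P; apply: cvg_trans sw.
  by apply: near_eq_cvg; apply: nearW => j /=; rewrite /f sqrtr_sqr.
rewrite -[X in _ --> X]add0r.
have E : \forall j \near \oo,
    (\sum_(i < k j) trunc (k j)%:R i w) / (k j)%:R - mean (k j)%:R
      + mean (k j)%:R = (\sum_(i < k j) Z i w) / (k j)%:R.
  apply: filterS truncE => j tE.
  by rewrite subrK; congr (_ / _); apply: eq_bigr => i _; rewrite tE.
apply: cvg_trans (near_eq_cvg E) _; exact: cvgD err mean_cvg.
Unshelve. all: by end_near. Qed.

End strong_law.

(** * Integer sequences of nearly geometric growth, and interpolation *)

Section geometric_growth.
Variable R : realType.

(** An integer substitute for the powers of [1 + 1 / m]. For [m > 0], the final [+ 1] makes the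
    increment exceed the current term divided by [m]. *)
Fixpoint geom_seq (m j : nat) : nat :=
  if j is j'.+1 then (geom_seq m j' + geom_seq m j' %/ m + 1)%N else 1%N.

Lemma geom_seq_ge m j : (j < geom_seq m j)%N.
Proof.
by elim: j => //= j IHj; rewrite addn1 ltnS (leq_trans IHj)// leq_addr.
Qed.

Lemma geom_seq_lt m j : (geom_seq m j < geom_seq m j.+1)%N.
Proof. by rewrite /= addn1 ltnS leq_addr. Qed.

(** This lower bound on the increments gives the summability in [geom_seq_sum]; the upper bound that
    follows keeps consecutive terms comparable. *)
Lemma geom_seq_growth m j : (0 < m)%N ->
  (geom_seq m j)%:R <= m%:R * ((geom_seq m j.+1)%:R - (geom_seq m j)%:R) :> R.
Proof.
move=> m0; rewrite mulrBr -!natrM lerBrDr -natrD ler_nat /=.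
have := divn_eq (geom_seq m j) m; have := ltn_pmod (geom_seq m j) m0.
by nia.
Qed.

Lemma geom_seq_ub m j : (0 < m)%N ->
  m%:R * ((geom_seq m j.+1)%:R - (geom_seq m j)%:R)
    <= (geom_seq m j)%:R + m%:R :> R.
Proof.
move=> m0; rewrite mulrBr -!natrM lerBlDr -!natrD ler_nat /=.
have := divn_eq (geom_seq m j) m; have := ltn_pmod (geom_seq m j) m0.
by nia.
Qed.

(* The potential is [G x = a min(x, 2z) - (a + 1) z^2 / max(x, z)]: each term of
   the series below is at most its increment. *)
Let potential (a z x : R) :=
  a * Num.min x (2 * z) - (a + 1) * (z ^+ 2 / Num.max x z).

(** For [x <= z] the first part of the potential pays: either [y] stays below [2 * z], or the gain
    is at least [a * z]. For [x > z] the second part pays, since [y <= (a + 1) * (y - x)]. *)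
Let potential_step a z x y : 1 <= a -> 0 < z -> 0 < x -> x <= a * (y - x) ->
  Num.min z x ^+ 2 / x <= potential a z y - potential a z x.
Proof.
move=> a1 z0 x0 xy.
have xley : x <= y by rewrite -subr_ge0; nra.
have y0 : 0 < y by exact: lt_le_trans xley.
rewrite /potential.
have [xz|zx] := leP x z.
  have -> : x ^+ 2 / x = x by field; rewrite gt_eqF.
  have M : z ^+ 2 / Num.max y z <= z ^+ 2 / z.
    rewrite ler_pM2l ?exprn_gt0// lef_pV2 ?posrE ?lt_max ?z0 ?orbT//.
    by rewrite le_max lexx orbT.
  have -> : Num.min x (2 * z) = x by rewrite min_l//; nra.
  have [y2z|y2z] := leP y (2 * z); nra.
have -> : Num.max y z = y by rewrite max_l// (le_trans (ltW zx)).
have M : Num.min x (2 * z) <= Num.min y (2 * z).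
  by rewrite le_min !ge_min xley lexx orbT.
suff : z ^+ 2 / x <= (a + 1) * (z ^+ 2 / x - z ^+ 2 / y) by nra.
have -> : z ^+ 2 / x - z ^+ 2 / y = z ^+ 2 / x * ((y - x) / y).
  by field; rewrite !gt_eqF.
rewrite mulrCA ler_pMr ?divr_gt0 ?exprn_gt0// mulrA ler_pdivlMr// mul1r; nra.
Qed.

Lemma geom_seq_sum m z n : (0 < m)%N -> 0 <= z ->
  \sum_(j < n) Num.min z (geom_seq m j)%:R ^+ 2 / (geom_seq m j)%:R
    <= (3 * m%:R + 1) * z :> R.
Proof.
move=> m0; rewrite le_eqVlt => /predU1P[<-|z0].
  rewrite mulr0 big1// => j _; rewrite min_l ?ler0n//.
  by rewrite expr0n mul0r.
have m1 : 1 <= m%:R :> R by rewrite ler1n.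
pose g j : R := (geom_seq m j)%:R.
have g0 j : 0 < g j by rewrite ltr0n (leq_trans _ (geom_seq_ge m j)).
have step : \sum_(j < n) Num.min z (g j) ^+ 2 / g j
    <= potential m%:R z (g n) - potential m%:R z (g 0%N).
  elim: n => [|n IHn]; first by rewrite big_ord0 subrr.
  rewrite big_ord_recr /=.
  have := potential_step m1 z0 (g0 n) (geom_seq_growth n m0).
  rewrite -/(g n.+1); lra.
(* The constant: the final potential is at most [2 * m * z], and the initial one is at least
   [- (m + 1) * z]. *)
apply: le_trans step _; rewrite /potential.
have h1 : Num.min (g n) (2 * z) <= 2 * z by rewrite ge_min lexx orbT.
have h2 : 0 <= Num.min (g 0%N) (2 * z).
  by rewrite le_min (ltW (g0 _)) mulr_ge0// ltW.
have h3 x : 0 <= z ^+ 2 / Num.max x z <= z.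
  have M : 0 < Num.max x z by rewrite lt_max z0 orbT.
  rewrite divr_ge0 ?sqr_ge0 ?(ltW M)//= ler_pdivrMr// expr2 ler_pM2l//.
  by rewrite le_max lexx orbT.
have /andP[h4 h5] := h3 (g 0%N); have /andP[h6 h7] := h3 (g n).
nra.
Qed.

Lemma geom_seq_bracket m J n : (geom_seq m J <= n)%N ->
  exists2 j, (J <= j)%N & (geom_seq m j <= n < geom_seq m j.+1)%N.
Proof.
elim: n => [|n IHn].
  by rewrite leqNgt (leq_ltn_trans _ (geom_seq_ge m J)).
rewrite leq_eqVlt => /predU1P[<-|].
  by exists J => //; rewrite leqnn geom_seq_lt.
rewrite ltnS => /IHn[j Jj /andP[jn nj]].
have [h|h] := ltnP n.+1 (geom_seq m j.+1).
  by exists j => //; rewrite h leqW.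
have e : geom_seq m j.+1 = n.+1 by apply/eqP; rewrite eqn_leq h nj.
exists j.+1; first exact: leqW.
by rewrite -e leqnn geom_seq_lt.
Qed.

(* Any [n] lies between two consecutive terms of [geom_seq m], whose ratio is
   eventually at most [1 + 2 / m]. *)
Lemma cvg_mean_geom_seq (S : nat -> R) (mu : R) :
  (forall n, 0 <= S n) -> {homo S : m n / (m <= n)%N >-> m <= n} ->
  (forall m, (0 < m)%N ->
    S (geom_seq m j) / (geom_seq m j)%:R @[j --> \oo] --> mu) ->
  S n / n%:R @[n --> \oo] --> mu.
Proof.
move=> S0 Shomo Scvg.
have gr0 m j : 0 < (geom_seq m j)%:R :> R.
  by rewrite ltr0n (leq_trans _ (geom_seq_ge m j)).
have mu0 : 0 <= mu.
  rewrite -(cvg_lim _ (Scvg 1%N isT))//.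
  apply: limr_ge; first by apply/cvg_ex; exists mu; exact: Scvg.
  by apply: nearW => j; rewrite divr_ge0.
apply/cvgrPdist_le => e e0.
(* So large that a factor [1 + 2 / m] moves a number of size at most [mu + e] by at most [e / 2]. *)
have [m m0 mb] : exists2 m, (0 < m)%N & 2 * (mu + e) * 2 <= e * m%:R.
  exists (Num.truncn (2 * (mu + e) * 2 / e)).+1 => //.
  by rewrite (mulrC e) -ler_pdivrMr// ltW// truncnS_gt.
have mR : 0 < m%:R :> R by rewrite ltr0n.
have e20 : 0 < e / 2 by rewrite divr_gt0.
have /cvgrPdist_le/(_ _ e20)[J _ HJ] := Scvg m m0.
(* Having [j >= m] forces [geom_seq m j >= m], which absorbs the additive [m] of [geom_seq_ub] into
   the ratio [1 + 2 / m]. *)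
exists (geom_seq m (maxn J m)) => // n /= /geom_seq_bracket[j jJ /andP[jn nj]].
have {jJ}[jJ jm] : (J <= j /\ m <= j)%N by move: jJ; rewrite geq_max => /andP.
have gj : m%:R <= (geom_seq m j)%:R :> R.
  by rewrite ler_nat (leq_trans jm)// ltnW// geom_seq_ge.
have ub := geom_seq_ub j m0.
have n0 : 0 < n%:R :> R by apply: lt_le_trans (gr0 m j) _; rewrite ler_nat.
have jnR : (geom_seq m j)%:R <= n%:R :> R by rewrite ler_nat.
have njR : n%:R <= (geom_seq m j.+1)%:R :> R by rewrite ler_nat ltnW.
have Sj : (mu - e / 2) * (geom_seq m j)%:R <= S n.
  apply: (@le_trans _ _ (S (geom_seq m j))); last exact: Shomo.
  have := HJ j jJ; rewrite ler_distl => /andP[_].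
  by rewrite -ler_pdivlMr// lerBlDr.
have Sj1 : S n <= (mu + e / 2) * (geom_seq m j.+1)%:R.
  apply: (@le_trans _ _ (S (geom_seq m j.+1))); first exact/Shomo/ltnW.
  have := HJ j.+1 (leqW jJ); rewrite ler_distl => /andP[+ _].
  by rewrite -ler_pdivrMr// lerBlDr.
move: (gr0 m j) (gr0 m j.+1) ub gj jnR njR Sj Sj1 (S0 n).
set a := (geom_seq m j)%:R; set b := (geom_seq m j.+1)%:R.
set M := m%:R in mb mR *.
move=> a0 b0 ub gj jnR njR Sj Sj1 Sn0.
have bM : M * b <= (M + 2) * a by nra.
rewrite ler_distl; apply/andP; split.
  rewrite lerBlDr ler_pdivrMr// -(ler_pM2l mR).
  apply: (@le_trans _ _ ((mu + e / 2) * ((M + 2) * a))).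
    apply: (@le_trans _ _ ((mu + e / 2) * (M * b))).
      by rewrite (mulrCA _ M) ler_pM2l.
    by rewrite ler_wpM2l// addr_ge0// ltW.
  apply: (@le_trans _ _ (M * (mu + e) * a)).
    by rewrite mulrA ler_pM2r//; nra.
  by rewrite mulrA ler_wpM2l// mulr_ge0// ?ltW// ltr_wpDl.
rewrite -lerBlDr ler_pdivlMr//.
have [me|me] := leP (mu - e) 0.
  by apply: le_trans Sn0; rewrite mulr_le0_ge0// ltW.
rewrite -(ler_pM2l mR).
apply: (@le_trans _ _ ((mu - e) * ((M + 2) * a))).
  apply: (@le_trans _ _ ((mu - e) * (M * b))).
    by rewrite (mulrCA M) ler_pM2l// ler_pM2l.
  by rewrite ler_pM2l.
apply: (@le_trans _ _ (M * ((mu - e / 2) * a))); last by rewrite ler_pM2l.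
by rewrite !mulrA ler_pM2r//; nra.
Qed.

End geometric_growth.

Section strong_law_of_large_numbers.
Context d (T : measurableType d) (R : realType) (P : probability T R).

(** Almost surely the subsequence law holds for all the countably many [m] at once; as the [Z i] are
    non-negative, the partial sums are monotone and can be interpolated. *)
Theorem strong_law (Z : nat -> {RV P >-> R}) :
  (forall i w, 0 <= Z i w) ->
  (forall i A, measurable A -> P (Z i @^-1` A) = P (Z 0%N @^-1` A)) ->
  (forall i j, i != j -> forall A B, measurable A -> measurable B ->
    P (Z i @^-1` A `&` Z j @^-1` B) = (P (Z i @^-1` A) * P (Z j @^-1` B))%E) ->
  ('E_P[Z 0%N] < +oo)%E ->
  {ae P, forall w,
    (\sum_(i < n) Z i w) / n%:R @[n --> \oo] --> fine 'E_P[Z 0%N]}.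
Proof.
move=> Z0 Zlaw Zind Zint.
have sub m : {ae P, forall w, (\sum_(i < geom_seq m.+1 j) Z i w)
    / (geom_seq m.+1 j)%:R @[j --> \oo] --> fine 'E_P[Z 0%N]}.
  apply: (@subsequence_strong_law _ _ _ _ Z Z0 Zlaw Zind Zint _
    (3 * m.+1%:R + 1)).
  - by move=> j; apply: leq_ltn_trans (geom_seq_ge _ j).
  - apply/cvgryPge => A.
    have : \forall j \near \oo, A <= j%:R by exact: nbhs_infty_ger.
    apply: filterS => j /le_trans; apply.
    by rewrite ler_nat ltnW// geom_seq_ge.
  - by move=> z n z0; exact: geom_seq_sum.
apply: filterS (ae_foralln sub) => w Zw.
apply: (@cvg_mean_geom_seq _ (fun n => \sum_(i < n) Z i w)).
- by move=> n; apply: sumr_ge0.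
- move=> p q pq; rewrite -(subnKC pq) big_split_ord/= lerDl.
  by apply: sumr_ge0.
- by case=> // m _; exact: Zw.
Qed.

End strong_law_of_large_numbers.

(** * Gluing almost isometric spaces *)

Section glued_space.
Variables (R : realType) (E1 E2 : metricType R) (f : E2 -> E1) (eps : R).
Hypothesis eps_gt0 : 0 < eps.
Hypothesis f_distortion :
  forall s t, `|mdist (f s) (f t) - mdist s t| <= eps.

(* The two proofs are arguments so that the type can carry the metric below. *)
Definition glued of 0 < eps &
    (forall s t, `|mdist (f s) (f t) - mdist s t| <= eps) : Type :=
  (E1 + E2)%type.

Let M := glued eps_gt0 f_distortion.

HB.instance Definition _ := Choice.copy M (E1 + E2)%type.

(** The cost of the cheapest route from [x] to [y] that jumps from some [f u] to [u], each jump
    costing [eps]. *)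
Definition bridge (x : E1) (y : E2) : R :=
  inf (range (fun u => mdist x (f u) + mdist u y)) + eps.

Lemma bridge_le u x y : bridge x y <= mdist x (f u) + mdist u y + eps.
Proof.
rewrite lerD2r; apply: inf_lbound; last by exists u.
by exists 0 => _ [v _ <-]; rewrite addr_ge0// mdist_ge0.
Qed.

Lemma le_bridge r x y :
  (forall u, r <= mdist x (f u) + mdist u y + eps) -> r <= bridge x y.
Proof.
move=> rb; rewrite -lerBlDr; apply: lb_le_inf.
  by exists (mdist x (f y) + mdist y y); exists y.
by move=> _ [u _ <-]; rewrite lerBlDr.
Qed.

Lemma bridge_gt0 x y : 0 < bridge x y.
Proof.
apply: lt_le_trans eps_gt0 _; apply: le_bridge => u.
by rewrite lerDr addr_ge0// mdist_ge0.
Qed.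

Definition glued_dist (a b : M) : R :=
  match a, b with
  | inl x, inl x' => mdist x x'
  | inr y, inr y' => mdist y y'
  | inl x, inr y => bridge x y
  | inr y, inl x => bridge x y
  end.

Let bridge_trianglel x x' y : bridge x y <= mdist x x' + bridge x' y.
Proof.
rewrite -lerBlDl; apply: le_bridge => u; rewrite lerBlDl.
apply: le_trans (bridge_le u x y) _.
by have := metric_triangle x x' (f u); lra.
Qed.

Let bridge_triangler x y y' : bridge x y <= bridge x y' + mdist y' y.
Proof.
rewrite -lerBlDr; apply: le_bridge => u; rewrite lerBlDr.
apply: le_trans (bridge_le u x y) _.
by have := metric_triangle u y' y; lra.
Qed.

(** A detour through [E2] that leaves at [f u] and returns at [f v] saves at most [eps] by the
    distortion bound, and its two jumps cost more. *)
Let le_bridgel x x' y : mdist x x' <= bridge x y + bridge x' y.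
Proof.
rewrite -lerBlDr; apply: le_bridge => u; rewrite lerBlDr -lerBlDl.
apply: le_bridge => v; rewrite lerBlDl.
have := f_distortion u v; rewrite ler_distl => /andP[_ d].
have := metric_triangle x (f u) x'; have := metric_triangle (f u) (f v) x'.
have := metric_triangle u y v.
rewrite (metric_sym (f v) x') (metric_sym y v).
move: eps_gt0 d; lra.
Qed.

Let le_bridger x y y' : mdist y y' <= bridge x y + bridge x y'.
Proof.
rewrite -lerBlDr; apply: le_bridge => u; rewrite lerBlDr -lerBlDl.
apply: le_bridge => v; rewrite lerBlDl.
have := f_distortion u v; rewrite ler_distl => /andP[d _].
have := metric_triangle y u y'; have := metric_triangle u v y'.
have := metric_triangle (f u) x (f v).
rewrite (metric_sym (f u) x) (metric_sym y u).
move: eps_gt0 d; lra.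
Qed.

Lemma glued_distxx a : glued_dist a a = 0.
Proof. by case: a => x; exact: mdistxx. Qed.

Lemma glued_dist_positivity a b : glued_dist a b = 0 -> a = b.
Proof.
case: a b => [x|y] [x'|y'] /= h.
- by congr (_ _); exact: mdist_positivity h.
- by have := bridge_gt0 x y'; rewrite h ltxx.
- by have := bridge_gt0 x' y; rewrite h ltxx.
- by congr (_ _); exact: mdist_positivity h.
Qed.

Lemma glued_dist_sym a b : glued_dist a b = glued_dist b a.
Proof. by case: a b => [x|y] [x'|y'] //=; exact: metric_sym. Qed.

Lemma glued_dist_triangle b a c :
  glued_dist a c <= glued_dist a b + glued_dist b c.
Proof.
case: b a c => [b|b] [a|a] [c|c] /=; rewrite ?metric_triangle//.
- by rewrite addrC (metric_sym b); exact: bridge_trianglel.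
- by rewrite addrC (metric_sym a); exact: bridge_triangler.
Qed.

HB.instance Definition _ := @isMetric.Build R M glued_dist
  glued_distxx glued_dist_positivity glued_dist_sym glued_dist_triangle.

(** In the glued space [f y] and [y] are at distance at most [eps], and by surjectivity every point
    of [E1] is some [f y]. *)
Lemma gromov_hausdorff_le : range f = setT ->
  (gromov_hausdorff_dist E1 E2 <= eps%:E)%E.
Proof.
move=> fT.
pose i1 : E1 -> M := inl; pose i2 : E2 -> M := inr.
apply: (@le_trans _ _ (hausdorff_dist (range i1) (range i2))).
  apply: ereal_inf_lbound; exists M, i1, i2; split => //.
have b y : bridge (f y) y <= eps.
  by apply: le_trans (bridge_le y _ _) _; rewrite !mdistxx !add0r.
rewrite /hausdorff_dist ge_max; apply/andP; split; apply: ge_ereal_sup.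
- move=> _ [_ [x _ <-] <-].
  have [y _ fy] : range f x by rewrite fT.
  apply: ereal_inf_le; exists (mdist (i1 x) (i2 y))%:E => //.
    by exists (i2 y) => //; exists y.
  by rewrite lee_fin -fy; exact: b.
- move=> _ [_ [y _ <-] <-].
  apply: ereal_inf_le; exists (mdist (i2 y) (i1 (f y)))%:E => //.
    by exists (i1 (f y)) => //; exists (f y).
  by rewrite lee_fin; exact: b.
Qed.

End glued_space.

(** The point of [E1] makes the first supremum range over a non-empty set; an empty supremum is
    [-oo]. *)
Lemma gromov_hausdorff_ge0 (R : realType) (E1 E2 : metricType R) : E1 ->
  (0 <= gromov_hausdorff_dist E1 E2)%E.
Proof.
move=> x; apply: le_ereal_inf_tmp => _ [M [i1 [i2 [_ _ ->]]]].
rewrite /hausdorff_dist le_max; apply/orP; left.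
apply: (@le_trans _ _ (dist_to_set (i1 x) (range i2))).
  by apply: le_ereal_inf_tmp => _ [z _ <-]; rewrite lee_fin mdist_ge0.
by apply: ereal_sup_ubound; exists (i1 x) => //; exists x.
Qed.

(** * Functionals of the sample paths *)

Section compact_metric.
Variables (R : realType) (K : metricType R).
Hypothesis K_compact : compact [set: K].

Lemma compact_ball_cover (r : K -> R) : (forall x, 0 < r x) ->
  exists D : {fset K}, forall x, exists2 p, p \in D & mdist p x < r p.
Proof.
move=> r0.
have [[x0 _]|K0] := pselect ([set: K] !=set0); last first.
  by exists fset0 => x; exfalso; apply: K0; exists x.
pose K' : ptopologicalType := HB.pack (Metric.sort K) (isPointed.Build _ x0).
have := @compact_cover K'; move=> cc.
have : @cover_compact K' [set: K'] by rewrite -cc.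
move=> /(_ K' setT (fun p => interior (ball (p : K) (r p)))) [].
- by move=> p _; exact: open_interior.
- by move=> p _; exists p => //; apply: nbhsx_ballx.
move=> D _ Dcov; exists D => x; have [p pD] := Dcov x I.
move=> /interior_subset; rewrite ballEmdist /= => xp.
by exists p.
Qed.

(** The sequence runs through finite nets of mesh [1 / (n + 1)]: an integer codes a net and a
    position in it, and [x0] fills the places that code nothing. *)
Lemma compact_dense_seq (x0 : K) :
  exists a : nat -> K, forall x e, 0 < e -> exists n, mdist (a n) x < e.
Proof.
pose r n : R := n.+1%:R^-1.
have r0 n : 0 < r n by rewrite invr_gt0.
have /choice[D Dcov] n : exists D : {fset K}, forall x,
    exists2 p, p \in D & mdist p x < r n.
  exact: (@compact_ball_cover (fun=> r n) (fun=> r0 n)).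
exists (fun k => if (choice.unpickle k : option (nat * nat)) is Some (n, i)
  then nth x0 (D n) i else x0).
move=> x e e0.
have [n rn] : exists n, r n < e.
  exists (Num.truncn (e^-1)); rewrite invf_plt ?posrE//.
  exact: truncnS_gt.
have [p pD px] := Dcov n x.
exists (choice.pickle (n, index p (D n))); rewrite choice.pickleK nth_index//.
exact: lt_trans rn.
Qed.

Lemma compact_continuous_bounded (f : K -> R) : continuous f ->
  exists M, forall x, `|f x| <= M.
Proof.
move=> cf.
have [K0|K0] := pselect ([set: K] !=set0); last first.
  by exists 0 => x; exfalso; apply: K0; exists x.
have cf' : {within [set: K], continuous (fun x => `|f x|)}.
  apply: continuous_subspaceT => x; apply: continuous_comp; first exact: cf.
  exact: norm_continuous.
have [c _ fc] := compact_EVT_max K0 K_compact cf'.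
by exists `|f c| => x; apply: fc; rewrite inE.
Qed.

End compact_metric.

(** * The strong law for measurable functionals of paths *)

Section path_space.
Context (R : realType) (K : Type).

(** The generators of [path_measurable], named so that [paths] is a measurable type with exactly
    those measurable sets. *)
Definition cylinders : set (set (K -> R)) :=
  [set A | exists (t : K) (B : set R),
     measurable B /\ A = (fun f : K -> R => f t) @^-1` B].

Definition paths := g_sigma_algebraType cylinders.

Lemma measurable_coordinate t :
  measurable_fun [set: paths] (fun f : paths => f t).
Proof.
move=> _ B mB; rewrite setTI; apply: sub_sigma_algebra.
by exists t, B.
Qed.

Lemma measurable_sample_path d (T : measurableType d) (P : probability T R)
    (X : K -> {RV P >-> R}) :
  measurable_fun setT (sample_path X : T -> paths).
Proof.
apply: (@measurability _ _ T paths setT _ cylinders) => //.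
move=> _ [_ [t [B [mB ->]]] <-].
rewrite setTI; have := measurable_funPT (X t) measurableT B mB.
by rewrite setTI.
Qed.

Context d (T : measurableType d) (P : probability T R).
Context d' (T' : measurableType d') (P' : probability T' R).

Lemma path_strong_law (X : K -> {RV P >-> R}) (Y : nat -> K -> {RV P' >-> R})
    (F : paths -> R) :
  measurable_fun setT F -> (forall f, 0 <= F f) ->
  (forall i, same_law X (Y i)) -> independent_processes Y ->
  ('E_P[F \o sample_path X] < +oo)%E ->
  {ae P', forall w, (\sum_(i < n) F (sample_path (Y i) w)) / n%:R
    @[n --> \oo] --> fine 'E_P[F \o sample_path X]}.
Proof.
move=> mF F0 XY Yind FX.
have mZ i : measurable_fun setT (F \o sample_path (Y i)).
  by apply: measurableT_comp => //; exact: measurable_sample_path.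
have mU : measurable_fun setT (F \o sample_path X).
  by apply: measurableT_comp => //; exact: measurable_sample_path.
pose Z i : {RV P' >-> R} :=
  HB.pack (F \o sample_path (Y i)) (isMeasurableFun.Build _ _ _ _ _ (mZ i)).
pose U : {RV P >-> R} :=
  HB.pack (F \o sample_path X) (isMeasurableFun.Build _ _ _ _ _ mU).
have cylF A : measurable A -> path_measurable (F @^-1` A).
  by move=> mA; have := mF measurableT A mA; rewrite setTI.
have ZU i A : measurable A -> P' (Z i @^-1` A) = P (U @^-1` A).
  by move=> mA; apply/esym; exact: XY i _ (cylF A mA).
have EZU : ('E_P'[Z 0%N] = 'E_P[U])%E.
  rewrite unlock.
  have := @eq_distribution_integral _ _ _ _ _ _ _ (Z 0%N) U (Num.max 0)
    (ZU 0%N).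
  under eq_integral => w _ do rewrite max_r ?F0//.
  have -> : (\int[P]_w (Num.max 0 (U w))%:E = \int[P]_w (U w)%:E)%E.
    by apply: eq_integral => w _; rewrite max_r//; exact: F0.
  apply; first exact: measurable_maxr.
  by move=> x; rewrite le_max lexx.
rewrite -[X in {ae _, forall w, _ --> fine X}]EZU.
apply: (@strong_law _ _ _ _ Z).
- by move=> i w; exact: F0.
- by move=> i A mA; rewrite !ZU.
- move=> i j ij A B mA mB.
  (* Pairwise independence is the case of a two-element index set. *)
  have := Yind [fset i; j]%fset
    (fun k => if k == i then F @^-1` A else F @^-1` B).
  have ji : (j == i) = false by rewrite eq_sym; exact/negbTE.
  rewrite big_fsetU1/=; last by rewrite inE.
  rewrite big_seq_fset1 eqxx ji => <-; last first.
    by move=> k _; case: ifP => _; exact: cylF.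
  congr (P' _); apply/seteqP; split=> [w [wA wB] k /=|w h].
    by rewrite !inE => /orP[/eqP ->|/eqP ->]; rewrite ?eqxx ?ji.
  have := h i; have := h j; rewrite /= !inE !eqxx orbT ji.
  by move=> /(_ isT) ? /(_ isT).
- by rewrite EZU.
Qed.

End path_space.

(** * Oscillation of a path around a point *)

Section oscillation.
Variables (R : realType) (K : metricType R) (a : nat -> K).
Implicit Types (f : paths R K) (p : K) (r : R).

(** Running along the sequence [a] keeps the supremum countable, hence measurable; the value 0 off
    the ball is harmless among squares. *)
Definition oscillation_at p r n f : R :=
  if mdist p (a n) < r then (f (a n) - f p) ^+ 2 else 0.

(* [esups u 0%N] is the supremum of all the [u n]; it may be infinite when [f]
   is discontinuous, and then [fine] makes the oscillation 0. *)
Definition oscillation p r f : R :=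
  fine (esups (fun n => (oscillation_at p r n f)%:E) 0%N).

Lemma esups0_le (u : nat -> \bar R) M :
  (esups u 0%N <= M)%E <-> forall n, (u n <= M)%E.
Proof.
split=> [uM n|uM].
  by apply: le_trans uM; apply: ereal_sup_ubound; exists n.
by apply: ge_ereal_sup => _ [n _ <-].
Qed.

Lemma oscillation_at_ge0 p r n f : 0 <= oscillation_at p r n f.
Proof. by rewrite /oscillation_at; case: ifP => // _; exact: sqr_ge0. Qed.

Let esups_ge0 p r f : (0 <= esups (fun n => (oscillation_at p r n f)%:E) 0%N)%E.
Proof.
apply: (@le_trans _ _ (oscillation_at p r 0%N f)%:E).
  by rewrite lee_fin oscillation_at_ge0.
by apply: ereal_sup_ubound; exists 0%N.
Qed.

Lemma oscillation_ge0 p r f : 0 <= oscillation p r f.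
Proof. exact: fine_ge0. Qed.

Lemma measurable_oscillation p r :
  measurable_fun setT (oscillation p r).
Proof.
apply: (@measurableT_comp _ _ _ _ _ _ fine); first exact: fine_measurable.
apply: measurable_fun_esups => n; apply/measurable_EFinP.
rewrite /oscillation_at; case: (mdist p (a n) < r); last exact: measurable_cst.
apply/measurable_funX/measurable_funB; exact: measurable_coordinate.
Qed.

(** On non-negative extended reals [fine] never increases the value, so an infinite supremum does no
    harm. *)
Lemma oscillation_leE p r f (M : \bar R) : (0 <= M)%E ->
  (forall n, mdist p (a n) < r -> (((f (a n) - f p) ^+ 2)%:E <= M)%E) ->
  ((oscillation p r f)%:E <= M)%E.
Proof.
move=> M0 fM.
have /esups0_le : forall n, ((oscillation_at p r n f)%:E <= M)%E.
  by move=> n; rewrite /oscillation_at; case: ifP => // /fM.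
apply: le_trans; move: (esups_ge0 p r f); rewrite /oscillation.
by case: esups => //=.
Qed.

Hypothesis K_compact : compact [set: K].
Hypothesis a_dense : forall x e, 0 < e -> exists n, mdist (a n) x < e.

(** By compactness the supremum is finite. Were the inequality false at [s], by continuity it would
    fail near [s], thus at some [a n] still inside the ball around [p]. *)
Lemma le_oscillation p r f s : continuous (f : K -> R) -> mdist p s < r ->
  (f s - f p) ^+ 2 <= oscillation p r f.
Proof.
move=> cf ps; have [M fM] := compact_continuous_bounded K_compact cf.
have fin : esups (fun n => (oscillation_at p r n f)%:E) 0%N \is a fin_num.
  rewrite ge0_fin_numE//.
  apply: (@le_lt_trans _ _ ((2 * M) ^+ 2)%:E); last exact: ltry.
  apply/esups0_le => n; rewrite lee_fin /oscillation_at.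
  case: ifP => _; last exact: sqr_ge0.
  have := fM (a n); have := fM p.
  by rewrite !ler_norml => /andP[? ?] /andP[? ?]; nra.
have atn n : oscillation_at p r n f <= oscillation p r f.
  by rewrite -lee_fin fineK//; apply: ereal_sup_ubound; exists n.
rewrite leNgt; apply/negP => lt_osc.
have cg : (f t - f p) ^+ 2 @[t --> s] --> (f s - f p) ^+ 2.
  apply: (@continuous_comp _ _ _ (fun t => f t - f p) (fun x => x ^+ 2)).
    by apply: continuousB => //; [exact: cf|exact: cst_continuous].
  exact: exprn_continuous.
have : \forall t \near s, oscillation p r f < (f t - f p) ^+ 2.
  exact: cvgr_gt cg _ lt_osc.
move=> /nbhs_ballP[e /= e0 se].
have r0 : 0 < r - mdist p s by rewrite subr_gt0.
have er0 : 0 < Num.min e (r - mdist p s) by rewrite lt_min e0.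
have [n] := a_dense s er0.
rewrite lt_min => /andP[ne nr].
have /= : ball s e (a n) by rewrite ballEmdist /= metric_sym.
move=> /se /=; rewrite ltNge => /negP; apply.
apply: le_trans (atn n); rewrite /oscillation_at ifT//.
by have := metric_triangle p s (a n); rewrite (metric_sym s); lra.
Qed.

Lemma oscillation_cvg0 p f : continuous (f : K -> R) ->
  oscillation p n.+1%:R^-1 f @[n --> \oo] --> (0 : R).
Proof.
move=> cf; apply/cvgrPdist_le => e e0.
(* A difference below both [e] and 1 has its square below [e]. *)
have e1 : 0 < Num.min e 1 by rewrite lt_min e0 ltr01.
have /cvgrPdist_lt/(_ _ e1)/nbhs_ballP[r /= r0 pr] := cf p.
near=> n.
rewrite sub0r normrN ger0_norm ?oscillation_ge0// -lee_fin.
apply: oscillation_leE => [|m pm]; first by rewrite lee_fin ltW.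
have /pr/= : ball p r (a m).
  rewrite ballEmdist/=; apply: lt_trans pm _.
  by near: n; exact: (near_infty_natSinv_lt (PosNum r0)).
rewrite lee_fin lt_min ltr_norml => /andP[/andP[? ?]].
by rewrite ltr_norml => /andP[? ?]; nra.
Unshelve. all: by end_near. Qed.

End oscillation.

(** * Expected oscillation of the process *)

Section mean_oscillation.
Variables (R : realType) (K : metricType R).
Context d (T : measurableType d) (P : probability T R).
Variable X : K -> {RV P >-> R}.
Hypothesis X_square_integrable :
  forall t, ('E_P[fun w => (X t w ^+ 2)%R] < +oo)%E.
Hypothesis X_continuous : {ae P, forall w, continuous (fun t => X t w)}.
Hypothesis X_sup_integrable :
  (\int[P]_w ereal_sup (range (fun t => ((X t w ^+ 2)%R)%:E)) < +oo)%E.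
Variable a : nat -> K.

Let sup_sqr w : \bar R := esups (fun n => (X (a n) w ^+ 2)%:E) 0%N.

Let sup_sqr_ge0 w : (0 <= sup_sqr w)%E.
Proof.
apply: (@le_trans _ _ (X (a 0%N) w ^+ 2)%:E); first by rewrite lee_fin sqr_ge0.
by apply: ereal_sup_ubound; exists 0%N.
Qed.

Let measurable_sup_sqr : measurable_fun setT sup_sqr.
Proof.
apply: measurable_fun_esups => n; apply/measurable_EFinP.
exact: measurable_funX.
Qed.

Let integrable_sup_sqr : P.-integrable setT sup_sqr.
Proof.
apply/integrableP; split => //.
under eq_integral => w _ do rewrite gee0_abs//.
apply: le_lt_trans X_sup_integrable.
have sup_ge0 w : (0 <= ereal_sup (range (fun t => ((X t w ^+ 2)%R)%:E)))%E.
  apply: (@le_trans _ _ (X (a 0%N) w ^+ 2)%:E).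
    by rewrite lee_fin sqr_ge0.
  by apply: ereal_sup_ubound; exists (a 0%N).
(* The supremum over all of [K] may fail to be measurable, so the integrals are compared through the
   simple functions below each integrand. *)
rewrite !ge0_integralTE//; apply: ge_ereal_sup => _ [h hle <-].
apply: ereal_sup_ubound; exists h => // w; apply: le_trans (hle w) _.
by apply/esups0_le => n; apply: ereal_sup_ubound; exists (a n).
Qed.

Lemma mean_oscillation_cvg0 p :
  ('E_P[oscillation a p n.+1%:R^-1 \o sample_path X] @[n --> \oo] --> 0)%E.
Proof.
pose g w : \bar R := (2%:E * sup_sqr w + 2%:E * (X p w ^+ 2)%:E)%E.
have ig : P.-integrable setT g.
  apply: integrableD => //; first exact: integrableZl.
  apply: integrableZl => //.
  exact: Lfun2_integrable_sqr (sqr_integrable_Lfun2 (X_square_integrable p)).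
have mosc n : measurable_fun setT (fun w =>
    (oscillation a p n.+1%:R^-1 (sample_path X w))%:E).
  apply/measurable_EFinP.
  apply: (measurableT_comp (measurable_oscillation _ _ _)).
  exact: measurable_sample_path.
have [] := @dominated_convergence _ _ _ P setT measurableT
  (fun n w => (oscillation a p n.+1%:R^-1 (sample_path X w))%:E)
  (cst 0%E) g mosc _ _ ig.
- exact: measurable_cst.
- apply: filterS X_continuous => w cw _.
  apply: cvg_EFin; first exact: nearW.
  exact: (@oscillation_cvg0 R K a p (sample_path X w) cw).
- apply: aeW => w n _; rewrite gee0_abs ?lee_fin ?oscillation_ge0//.
  apply: oscillation_leE => [|m _].
    by rewrite adde_ge0// mule_ge0// lee_fin sqr_ge0.
  apply: (@le_trans _ _
    (2%:E * (X (a m) w ^+ 2)%:E + 2%:E * (X p w ^+ 2)%:E)%E).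
    rewrite -!EFinM -EFinD lee_fin /sample_path.
    by rewrite -subr_ge0; have := sqr_ge0 (X (a m) w + X p w); nra.
  rewrite leeD2r// lee_wpmul2l//.
  by apply: ereal_sup_ubound; exists m.
move=> _ _; rewrite integral_cst// mul0e; apply: cvg_trans.
by apply: near_eq_cvg; apply: nearW => n /=; rewrite unlock.
Qed.

(** The requirement [r <= e] also keeps the points of the ball close to its center in [K]. *)
Lemma small_mean_oscillation p (e e' : R) : 0 < e -> 0 < e' -> exists r,
  [/\ 0 < r, r <= e & ('E_P[oscillation a p r \o sample_path X] < e'%:E)%E].
Proof.
move=> e0 e'0.
have : \forall n \near \oo, n.+1%:R^-1 < e /\
    ('E_P[oscillation a p n.+1%:R^-1 \o sample_path X] < e'%:E)%E.
  apply: filterI; first exact: (near_infty_natSinv_lt (PosNum e0)).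
  have /fine_cvgP[fin lim] := mean_oscillation_cvg0 p.
  have small := cvgr_lt _ lim _ e'0.
  near=> n; rewrite -[ltLHS]fineK ?lte_fin; near: n; [exact: small|exact: fin].
move=> /filter_ex[n [ne nE]]; exists n.+1%:R^-1; split => //; exact: ltW.
Unshelve. all: by end_near. Qed.

End mean_oscillation.

Section embedding_distance.
Variables (R : realType) (K : metricType R).
Context d (T : measurableType d) (P : probability T R).
Variable Y : nat -> K -> {RV P >-> R}.

Lemma random_embedding_dist w n s t :
  mdist (random_embedding Y w n s) (random_embedding Y w n t) =
  Num.sqrt ((\sum_(i < n) (Y i s w - Y i t w) ^+ 2) / n%:R).
Proof.
rewrite -[LHS]/(euclidean_dist _ _) /euclidean_dist mulr_suml.
congr Num.sqrt; apply: eq_bigr => i _.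
by rewrite !mxE -mulrBl exprMn exprVn sqr_sqrtr.
Qed.

End embedding_distance.

Lemma filter_forall_in (T : Type) (F : set_system T) (I : eqType) (s : seq I)
    (Q : I -> T -> Prop) : Filter F ->
  (forall i, i \in s -> \forall x \near F, Q i x) ->
  \forall x \near F, forall i, i \in s -> Q i x.
Proof.
move=> FF; elim: s => [|i s IHs] Qs; first exact: nearW.
have := IHs (fun j js => Qs j (mem_behead (s := i :: s) js)).
apply: filterS2 (Qs i (mem_head _ _)) => x Qi Qx j.
by rewrite inE => /predU1P[->//|]; exact: Qx.
Qed.

(** * Uniform convergence of the embedded distances *)

Section distortion.
Variables (R : realType) (K : metricType R).
Context d (T : measurableType d) (P : probability T R).
Context d' (T' : measurableType d') (P' : probability T' R).
Variables (X : K -> {RV P >-> R}) (Y : nat -> K -> {RV P' >-> R}).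
Hypothesis X_centered : forall t, ('E_P[X t] = 0)%E.
Hypothesis X_square_integrable :
  forall t, ('E_P[fun w => (X t w ^+ 2)%R] < +oo)%E.
Hypothesis mdist_rho : forall s t,
  mdist s t = Num.sqrt (fine 'V_P[fun w => X s w - X t w]).

Lemma mean_sqr_increment s t :
  ('E_P[fun w => ((X s w - X t w) ^+ 2)%R] = (mdist s t ^+ 2)%:E)%E.
Proof.
have Pfin : P setT \is a fin_num := fin_num_measure P _ measurableT.
have X2 u := sqr_integrable_Lfun2 (X_square_integrable u).
have X1 u := Lfun_subset12 Pfin (X2 u).
have B2 : ((X s : T -> R) \- (X t : T -> R)) \in Lfun P 2%:E.
  by apply: rpredB => //=; rewrite lee1n.
rewrite mdist_rho sqr_sqrtr ?fine_ge0 ?variance_ge0// fineK ?variance_fin_num//.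
have E0 : ('E_P[(X s : T -> R) \- (X t : T -> R)] = 0)%E.
  by rewrite expectationB// !X_centered sube0.
rewrite /variance [in RHS]unlock E0; congr expectation.
by apply/funext => w /=; rewrite !fctE/= subr0 -expr2.
Qed.

Hypothesis K_nonempty : [set: K] !=set0.
Hypothesis K_compact : compact [set: K].
Hypothesis X_continuous : {ae P, forall w, continuous (fun t => X t w)}.
Hypothesis X_sup_integrable :
  (\int[P]_w ereal_sup (range (fun t => ((X t w ^+ 2)%R)%:E)) < +oo)%E.
Hypothesis Y_copies : forall i, same_law X (Y i).
Hypothesis Y_independent : independent_processes Y.
Hypothesis Y_continuous :
  forall i, {ae P', forall w, continuous (fun t => Y i t w)}.

Lemma ae_distortion (e : R) : 0 < e ->
  {ae P', forall w, \forall n \near \oo, forall s t,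
    `|mdist (random_embedding Y w n s) (random_embedding Y w n t) - mdist s t|
      <= 5 * e}.
Proof.
move=> e0; have [x0 _] := K_nonempty.
have [a a_dense] := compact_dense_seq K_compact x0.
have e20 : 0 < e ^+ 2 by rewrite exprn_gt0.
have /choice[r rP] p := small_mean_oscillation X_square_integrable X_continuous
  X_sup_integrable a p e0 e20.
have r0 p : 0 < r p by have [] := rP p.
have [D Dcov] := compact_ball_cover K_compact r0.
have osc_small p : {ae P', forall w, \forall n \near \oo,
    (\sum_(i < n) oscillation a p (r p) (sample_path (Y i) w)) / n%:R
      <= e ^+ 2}.
  have [_ _ rE] := rP p.
  have := path_strong_law (measurable_oscillation a p (r p))
    (oscillation_ge0 a p (r p)) Y_copies Y_independent (lt_trans rE (ltry _)).
  apply: filterS => w lim.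
  have Efin : ('E_P[oscillation a p (r p) \o sample_path X] \is a fin_num)%E.
    rewrite ge0_fin_numE ?(lt_trans rE (ltry _))//.
    by apply: expectation_ge0 => ?; exact: oscillation_ge0.
  have lt : fine 'E_P[oscillation a p (r p) \o sample_path X] < e ^+ 2.
    by rewrite -lte_fin fineK.
  by apply: filterS (cvgr_lt _ lim _ lt) => n /ltW.
have net_small p q : {ae P', forall w, \forall n \near \oo,
    `|mdist (random_embedding Y w n p) (random_embedding Y w n q) - mdist p q|
      <= e}.
  pose F (f : paths R K) : R := (f p - f q) ^+ 2.
  have mF : measurable_fun setT F.
    by apply/measurable_funX/measurable_funB; exact: measurable_coordinate.
  have F0 f : 0 <= F f by exact: sqr_ge0.
  have EF : ('E_P[F \o sample_path X] = (mdist p q ^+ 2)%:E)%E.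
    exact: mean_sqr_increment.
  have EFoo : ('E_P[F \o sample_path X] < +oo)%E by rewrite EF ltry.
  have := path_strong_law mF F0 Y_copies Y_independent EFoo.
  rewrite EF /=; apply: filterS => w lim.
  have := cvg_comp _ _ lim (@sqrt_continuous R (mdist p q ^+ 2)).
  rewrite sqrtr_sqr ger0_norm ?mdist_ge0// => /cvgrPdist_le/(_ _ e0).
  by apply: filterS => n; rewrite random_embedding_dist distrC.
have osc_all : {ae P', forall w, forall p, p \in D -> \forall n \near \oo,
    (\sum_(i < n) oscillation a p (r p) (sample_path (Y i) w)) / n%:R
      <= e ^+ 2}.
  by apply: filter_forall_in => p _; exact: osc_small.
have net_all : {ae P', forall w, forall p, p \in D -> forall q, q \in D ->
    \forall n \near \oo,
    `|mdist (random_embedding Y w n p) (random_embedding Y w n q) - mdist p q|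
      <= e}.
  apply: filter_forall_in => p _; apply: filter_forall_in => q _.
  exact: net_small.
have cont := ae_foralln Y_continuous.
(* From here on [w] is fixed and the argument is deterministic; as [D] is finite, one threshold on
   [n] serves all centers. *)
apply: filterS3 cont osc_all net_all => w Ycont oscw netw.
have osc_near : \forall n \near \oo, forall p, p \in D ->
    (\sum_(i < n) oscillation a p (r p) (sample_path (Y i) w)) / n%:R <= e ^+ 2.
  exact: filter_forall_in oscw.
have net_near : \forall n \near \oo, forall p, p \in D -> forall q, q \in D ->
    `|mdist (random_embedding Y w n p) (random_embedding Y w n q) - mdist p q|
      <= e.
  apply: filter_forall_in => p pD; apply: filter_forall_in => q qD.
  exact: netw.
apply: filterS2 osc_near net_near => n oscn netn.
have near_net s : exists2 p, p \in D & mdist s p <= e /\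
    mdist (random_embedding Y w n s) (random_embedding Y w n p) <= e.
  have [p pD ps] := Dcov s; exists p => //; split.
    have [_ re _] := rP p.
    by rewrite metric_sym ltW// (lt_le_trans ps).
  (* The squared distance is an average of squared increments, each bounded by the oscillation of
     its path because that path is continuous. *)
  rewrite random_embedding_dist -[leRHS]ger0_norm ?(ltW e0)// -sqrtr_sqr.
  apply: ler_wsqrtr; apply: le_trans (oscn p pD).
  rewrite ler_wpM2r// ler_sum// => i _.
  exact: (@le_oscillation R K a K_compact a_dense p (r p)
    (sample_path (Y i) w) s (Ycont i)).
move=> s t; have [p pD [sp sp']] := near_net s.
have [q qD [tq tq']] := near_net t.
(* The 5: replacing [s] and [t] by [p] and [q] costs [2 * e] in [K] and [2 * e] in the embedded
   space, and the centers cost [e]. *)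
have := netn p pD q qD; move: sp sp' tq tq'.
move: (random_embedding Y w n) => E sp sp' tq tq'.
rewrite !ler_norml => /andP[lo up].
have := metric_triangle s p t; have := metric_triangle p q t.
have := metric_triangle p s q; have := metric_triangle s t q.
have := metric_triangle (E s) (E p) (E t).
have := metric_triangle (E p) (E q) (E t).
have := metric_triangle (E p) (E s) (E q).
have := metric_triangle (E s) (E t) (E q).
rewrite (metric_sym p s) (metric_sym q t).
rewrite (metric_sym (E p) (E s)) (metric_sym (E q) (E t)).
move=> *; apply/andP; split; lra.
Qed.

End distortion.

(** * From small distortion to Gromov-Hausdorff convergence *)

Lemma gromov_hausdorff_cvg0 (R : realType) (K : metricType R)
    (d : measure_display) (T : measurableType d) (P : probability T R)
    (Y : nat -> K -> {RV P >-> R}) w : [set: K] !=set0 ->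
  (forall e, 0 < e -> \forall n \near \oo, forall s t,
    `|mdist (random_embedding Y w n s) (random_embedding Y w n t) - mdist s t|
      <= e) ->
  (fun n => gromov_hausdorff_dist (set_type (random_space Y w n)) K) @ \oo
    --> 0%E.
Proof.
move=> [x0 _] dist.
have inX n s : random_embedding Y w n s \in random_space Y w n.
  by rewrite inE; exists s.
pose f n s : random_space Y w n := SigSub (inX n s).
have fT n : range (f n) = setT.
  apply/seteqP; split => // -[x xX] _; have := xX; rewrite inE => -[s _ sx].
  by exists s => //; apply: val_inj.
have GH0 n := gromov_hausdorff_ge0 K (f n x0).
have GHle e : 0 < e -> \forall n \near \oo,
    (gromov_hausdorff_dist (set_type (random_space Y w n)) K <= e%:E)%E.
  move=> e0; apply: filterS (dist e e0) => n ne.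
  (* The induced metric is the Euclidean one by conversion, so [ne] bounds the distortion of
     [f n]. *)
  exact: (@gromov_hausdorff_le R _ _ (f n) e e0 ne (fT n)).
(* The distance is an extended real: it is eventually at most 1, hence finite, before convergence is
   checked in the reals. *)
apply: cvg_EFin.
  apply: filterS (GHle 1 ltr01) => n n1.
  by rewrite (ge0_fin_numE (GH0 n)); apply: (le_lt_trans n1); rewrite ltry.
apply/cvgrPdist_le => e e0; apply: filterS (GHle e e0) => n ne /=.
rewrite sub0r normrN ger0_norm ?(fine_ge0 (GH0 n))// -lee_fin fineK//.
by rewrite (ge0_fin_numE (GH0 n)); apply: (le_lt_trans ne); rewrite ltry.
Qed.

Theorem theorem2p6 (R : realType) (K : metricType R)
  (dO : measure_display) (Omega : measurableType dO) (P : probability Omega R)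
  (X : K -> {RV P >-> R})
  (dO' : measure_display) (Omega' : measurableType dO')
  (P' : probability Omega' R) (Y : nat -> K -> {RV P' >-> R})
  (K_nonempty : [set: K] !=set0)
  (X_centered : forall t, ('E_P[X t] = 0)%E)
  (X_square_integrable : forall t, ('E_P[fun w => (X t w ^+ 2)%R] < +oo)%E)
  (mdist_rho : forall s t,
    mdist s t = Num.sqrt (fine 'V_P[fun w => X s w - X t w]))
  (K_compact : compact [set: K])
  (X_continuous : {ae P, forall w, continuous (fun t => X t w)})
  (X_sup_integrable :
    (\int[P]_w ereal_sup (range (fun t => ((X t w ^+ 2)%R)%:E)) < +oo)%E)
  (Y_copies : forall i, same_law X (Y i))
  (Y_independent : independent_processes Y)
  (Y_continuous : forall i, {ae P', forall w, continuous (fun t => Y i t w)}) :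
  {ae P', forall w,
    (fun d => gromov_hausdorff_dist (set_type (random_space Y w d)) K) @ \oo
      --> 0%E}.
Proof.
(* Countably many tolerances give one almost sure event valid for every [e]; the division by 5
   offsets the factor in [ae_distortion]. *)
have e0 k : 0 < (k.+1%:R^-1 / 5 : R) by rewrite divr_gt0// invr_gt0.
have := ae_foralln (fun k => ae_distortion X_centered X_square_integrable
  mdist_rho K_nonempty K_compact X_continuous X_sup_integrable Y_copies
  Y_independent Y_continuous (e0 k)).
apply: filterS => w dist; apply: gromov_hausdorff_cvg0 => // e e_gt0.
have /filter_ex[k ke] := near_infty_natSinv_lt (PosNum e_gt0).
apply: filterS (dist k) => n nk s t; apply: le_trans (nk s t) _.
by rewrite mulrC divfK// ltW.
Qed.
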